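(* For a simplicial subcomplex $X\subseteq\partial\Delta_n$, the geometric realisation of the simplicial complex $c(X)$ is homotopy equivalent to (the geometric realisation of) $X'$ and to the complement $\partial\Delta_n-X$ of $X$ in the sphere $\partial\Delta_n$.
   Context: $[n]=\{0,1,\dots,n\}$; $\partial\Delta_n$ is the simplicial complex of all non-empty proper subsets (simplexes) of $[n]$; its geometric realisation is an $(n-1)$-sphere. The complement $\partial\Delta_n-X$ is taken in geometric realisations. For $\sigma\in\partial\Delta_n$, $\hat\sigma=[n]\setminus\sigma$. The combinatorial Alexander dual of $X$ is the simplicial complex $c(X)=\{\hat\sigma:\sigma\in\partial\Delta_n,\ \sigma\notin X\}$. $E(X)$ is the set of external simplexes of $X$: simplexes $\sigma\in\partial\Delta_n$ with $\sigma\notin X$ such that every non-empty proper subset of $\sigma$ belongs to $X$. The dual complex $X'$ is the abstract simplicial complex with vertex set $E(X)$ in which $\sigma_1,\dots,\sigma_k\in E(X)$ form a $(k-1)$-simplex iff $\bigcup_{i=1}^k\sigma_i\neq[n]$ (union of the vertex sets). *)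

(* Defs.v *)
From HB Require Import structures.
From mathcomp Require Import all_boot all_order all_algebra.
From mathcomp Require Import all_classical all_reals all_analysis.

Set Implicit Arguments.
Unset Strict Implicit.
Unset Printing Implicit Defensive.

Import Order.TTheory GRing.Theory Num.Theory.
Import numFieldNormedType.Exports.

Local Open Scope classical_set_scope.
Local Open Scope ring_scope.

(* Simplexes are non-empty. An element of the ambient type V need not be a
   vertex of K, and K may be empty. *)
Definition simplicial_complex (V : finType) (K : {set {set V}}) : Prop :=
  finset.set0 \notin K /\
  forall s t : {set V},
    s \in K -> t != finset.set0 -> t \subset s -> t \in K.

(* Barycentric coordinates. As V is finite, the topology induced from the
   product topology on V -> R is the usual topology of |K|. *)
Definition realisation (R : realType) (V : finType) (K : {set {set V}}) :
    set {ptws V -> R} :=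
  [set x | [/\ forall v, 0 <= x v, \sum_v x v = 1
             & [set v | x v != 0]%SET \in K]].

Arguments realisation R {V} K _.

(* H is a total function on R * S, of which only the restriction to
   [0, 1] * S matters. *)
Definition homotopic (R : realType) (S T : topologicalType) (f g : S -> T) :
    Prop :=
  exists H : R * S -> T,
    [/\ {within `[0, 1]%classic `*` [set: S], continuous H},
        forall x, H (0, x) = f x
      & forall x, H (1, x) = g x].

Definition homotopy_equivalent (R : realType) (S T : topologicalType) : Prop :=
  exists f : S -> T, exists g : T -> S,
    [/\ continuous f, continuous g,
        homotopic R (g \o f) idfun & homotopic R (f \o g) idfun].

(* [n] = {0, ..., n} is 'I_n.+1. *)
Definition simplex_boundary (n : nat) : {set {set 'I_n.+1}} :=
  [set s : {set 'I_n.+1} | (s != finset.set0) && (s \proper [set: 'I_n.+1])]%SET.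

Definition alexander_dual (n : nat) (X : {set {set 'I_n.+1}}) :
    {set {set 'I_n.+1}} :=
  [set (~: s)%SET | s in (simplex_boundary n :\: X)%SET]%SET.

Definition external_simplexes (n : nat) (X : {set {set 'I_n.+1}}) :
    {set {set 'I_n.+1}} :=
  [set s in simplex_boundary n | (s \notin X) &&
     [forall t : {set 'I_n.+1},
        (t != finset.set0) && (t \proper s) ==> (t \in X)]]%SET.

(* A simplex of the dual complex is a set of external simplexes, so this is a
   complex over {set 'I_n.+1}; finset.cover s is the union of the members of s. *)
Definition dual_complex (n : nat) (X : {set {set 'I_n.+1}}) :
    {set {set {set 'I_n.+1}}} :=
  [set s : {set {set 'I_n.+1}} |
     [&& s != finset.set0, s \subset external_simplexes X
       & finset.cover s != [set: 'I_n.+1]%SET]]%SET.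

Lemma simplicial_complex_boundary (n : nat) :
  simplicial_complex (simplex_boundary n).
Proof.
split=> [|s t]; rewrite !inE ?eqxx// => /andP[_ sT] -> ts /=.
exact: sub_proper_trans ts sT.
Qed.

Lemma simplicial_complex_alexander_dual (n : nat) (X : {set {set 'I_n.+1}}) :
  simplicial_complex X -> simplicial_complex (alexander_dual X).
Proof.
case=> _ Xdown; split.
  apply/imsetP => -[s]; rewrite !inE => /and3P[_ _ sT] s0.
  by move: sT; rewrite -[s]finset.setCK -s0 finset.setC0 fintype.properxx.
move=> _ t /imsetP[s + ->]; rewrite !inE => /and3P[sX s0 sT] t0 tCs.
have st : s \subset ~: t by rewrite finset.subsetC.
apply/imsetP; exists (~: t)%SET; last by rewrite finset.setCK.
rewrite !inE properT -finset.subTset; apply/and3P; split.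
- by apply: contra sX => tX; exact: Xdown tX s0 st.
- by apply: contra s0 => /eqP t'0; rewrite -finset.subset0 -t'0.
- by rewrite finset.subsetC finset.setCT finset.subset0.
Qed.

Lemma simplicial_complex_dual_complex (n : nat) (X : {set {set 'I_n.+1}}) :
  simplicial_complex (dual_complex X).
Proof.
split=> [|s t]; rewrite !inE ?eqxx// => /and3P[_ sE sT] -> ts /=.
rewrite (fintype.subset_trans ts sE) /=; apply: contra sT => /eqP tT.
rewrite -finset.subTset -tT; apply/bigcupsP => u ut.
by apply: finset.bigcup_max (subxx u); exact: (fintype.subsetP ts).
Qed.

Lemma mem_dual_complex1 (n : nat) (X : {set {set 'I_n.+1}})
    (s : {set 'I_n.+1}) :
  ([set s]%SET \in dual_complex X) = (s \in external_simplexes X).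
Proof.
rewrite inE finset.sub1set finset.cover1 -finset.card_gt0 finset.cards1 /=.
case: (boolP (s \in _)) => //=; rewrite !inE properT.
by case/and3P => /andP[].
Qed.

(* Main.v *)
Require Import Defs.
From mathcomp Require Import all_boot all_order all_algebra.
From mathcomp Require Import all_classical all_reals all_analysis.

Import numFieldNormedType.Exports.

(** A point of a realisation is a weight function [x]; besides its carrier (the
    set where it is non-zero) it has a peak (the set where it is maximal).
    Two points of the same realisation, one carrier containing the other, are
    joined by a segment inside the realisation.  So maps back and forth are
    homotopy inverse as soon as both composites only enlarge carriers
    ([realisation_homotopy_equivalent]), and what remains is to exhibit
    explicit maps and compute carriers.

    All the maps come from one construction.  For a relation [r] between finite
    sets V and W, send a weight function [x] on V to the weight function on W
      w |-> max x - max {x v | v not related to w},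
    normalised to sum 1.  Writing r(A) for the set of w related to all the
    members of A, this map turns peaks into carriers and carriers into peaks:
    the image of [x] has carrier r(peak x) ([carrier_gap_map]) and, if
    r(carrier x) is non-empty, peak r(carrier x) ([peak_gap_map]).  Hence two
    consecutive maps act on carriers by a composite of two r( ), that is, by
    the Galois connection of the relations involved.

    - For [r] and its converse the composite sends the carrier s to
      r'(r(s)), which contains s.  This is Dowker's duality
      ([dowker_duality]): the sets of v with a common related w, and the sets
      of w with a common related v, form homotopy equivalent complexes.  For
      the relation (v is not a vertex of the external simplex e) these two
      complexes are c(X) and X'.
    - For the relation v <> w the map is the antipodal map
      x |-> max x - x, whose carrier is the complement of the peak of [x]; it
      maps |c(X)| into the complement of |X|.  Going back, the antipodal map is
      followed by two maps of Dowker type, relating vertices to the simplexes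
      outside X ([complement_duality]). *)

Local Open Scope classical_set_scope.

Set Implicit Arguments.
Unset Strict Implicit.
Unset Printing Implicit Defensive.

Import Order.TTheory GRing.Theory Num.Theory.
Local Open Scope ring_scope.

(** * Carriers and straight-line homotopies *)

Definition carrier (R : realType) (V : finType) (x : V -> R) : {set V} :=
  [set v | x v != 0]%SET.

Definition in_simplex (R : realType) (V : finType) (x : V -> R) : Prop :=
  (forall v, 0 <= x v) /\ \sum_v x v = 1.

Lemma in_realisation (R : realType) (V : finType) (K : {set {set V}})
    (x : {ptws V -> R}) :
  realisation R K x <-> in_simplex x /\ carrier x \in K.
Proof. by split=> [[]|[[]]]. Qed.

Lemma coord_continuous (R : realType) (V : finType) (v : V) :
  continuous (fun x : {ptws V -> R} => x v : R).
Proof. exact: (@proj_continuous V (fun=> R) v). Qed.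

Lemma continuous_ptws (R : realType) (V : finType) (T : topologicalType)
    (f : T -> {ptws V -> R}) (t : T) :
  (forall v, {for t, continuous (fun s => f s v)}) -> {for t, continuous f}.
Proof.
move=> fc; apply/cvg_sup => v U [_ [[W oW <-] /= Wft] WU].
apply: filterS WU _; apply: (fc v); exact: open_nbhs_nbhs.
Qed.

Lemma continuous_set_type (X T : topologicalType) (A : set X)
    (f : T -> set_type A) :
  continuous (fun t => set_val (f t)) -> continuous f.
Proof. by move=> fc; apply: continuous_comp_initial. Qed.

Definition corestrict (X Y : Type) (A : set X) (B : set Y) (f : X -> Y)
    (fAB : forall x, A x -> B (f x)) (a : set_type A) : set_type B :=
  exist _ (f (set_val a)) (mem_set (fAB _ (set_valP a))).

Lemma corestrict_continuous (X Y : topologicalType) (A : set X) (B : set Y)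
    (f : X -> Y) (fAB : forall x, A x -> B (f x)) :
  (forall x, A x -> {for x, continuous f}) -> continuous (corestrict fAB).
Proof.
move=> fc; apply: continuous_set_type => a.
apply: (@continuous_comp _ _ _ set_val f); first exact: initial_continuous.
exact: fc (set_valP a).
Qed.

Section segment.
Variables (R : realType) (V : finType).

(** A homotopy has to be defined for all real times: outside [0, 1] it is
    kept constant, so that it never leaves the realisation. *)
Definition clamp (t : R) : R := Num.max 0 (Num.min 1 t).

Lemma clamp_itv t : 0 <= clamp t <= 1.
Proof.
by rewrite /clamp le_max lexx /= ge_max ler01 /= ge_min lexx.
Qed.

Lemma clamp_continuous : continuous clamp.
Proof.
apply: max_fun_continuous; first by move=> t; exact: cvg_cst.
by apply: min_fun_continuous => t; [exact: cvg_cst|exact: cvg_id].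
Qed.

Definition segment (t : R) (y x : V -> R) : {ptws V -> R} :=
  fun v => (1 - clamp t) * y v + clamp t * x v.

(** An inner point of the segment from [y] to [x] has as carrier the union of
    the two carriers, so it stays in the realisation when this union is one of
    them.  Here [K] is any family of carriers: |K| may be the complement of a
    subcomplex. *)
Lemma segment_realisation (K : {set {set V}}) t (x y : {ptws V -> R}) :
  realisation R K x -> realisation R K y -> carrier x \subset carrier y ->
  realisation R K (segment t y x).
Proof.
move=> /in_realisation[[x0 x1] xK] /in_realisation[[y0 y1] yK] xy.
have /andP[t0 t1] := clamp_itv t.
have t1' : 0 <= 1 - clamp t by rewrite subr_ge0.
apply/in_realisation; split; first split.
- by move=> v; rewrite addr_ge0 ?mulr_ge0.
- by rewrite big_split /= -!mulr_sumr x1 y1 !mulr1 subrK.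
have [tE|tN] := eqVneq (clamp t) 1.
  (* At the endpoint x the carrier shrinks to that of x. *)
  suff -> : carrier (segment t y x) = carrier x by [].
  by apply/setP => v; rewrite !inE /segment tE subrr mul0r add0r mul1r.
suff -> : carrier (segment t y x) = carrier y by [].
apply/setP => v; rewrite !inE /segment.
rewrite paddr_eq0 ?mulr_ge0// !mulf_eq0 subr_eq0 eq_sym (negbTE tN) /=.
have [y0v|//] := eqVneq (y v) 0.
have : v \notin carrier x.
  by apply: contraTN isT => /(fintype.subsetP xy); rewrite !inE y0v eqxx.
by rewrite !inE negbK => ->; rewrite orbT.
Qed.

Lemma segment_homotopic (K : {set {set V}})
    (h : set_type (realisation R K) -> set_type (realisation R K)) :
  continuous h ->
  (forall x, carrier (set_val x) \subset carrier (set_val (h x))) ->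
  homotopic R h idfun.
Proof.
move=> hc xh.
have mem (p : R * set_type (realisation R K)) :
    realisation R K (segment p.1 (set_val (h p.2)) (set_val p.2)).
  by apply: segment_realisation => //; exact: set_valP.
pose H (p : R * set_type (realisation R K)) : set_type (realisation R K) :=
  exist _ (segment p.1 (set_val (h p.2)) (set_val p.2)) (mem_set (mem p)).
exists H; split.
- apply: continuous_subspaceT; apply: continuous_set_type => p.
  apply: continuous_ptws => v; rewrite /segment /=.
  have clampc : {for p, continuous (fun q : R * set_type (realisation R K) =>
      clamp q.1)}.
    by apply: (@continuous_comp _ _ _ fst); [exact: cvg_fst|
      exact: clamp_continuous].
  have coordc (k : set_type (realisation R K) -> set_type (realisation R K)) :
      continuous k -> {for p, continuous
        (fun q : R * set_type (realisation R K) => set_val (k q.2) v : R)}.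
    move=> kc; apply: (@continuous_comp _ _ _ (fun q => set_val (k q.2))
      (fun y : {ptws V -> R} => y v)); last exact: coord_continuous.
    apply: (@continuous_comp _ _ _ (fun q => k q.2) set_val);
      last exact: initial_continuous.
    by apply: (@continuous_comp _ _ _ snd); [exact: cvg_snd|exact: kc].
  apply: cvgD; apply: cvgM => //; last by apply: (coordc idfun) => ?.
  - by apply: cvgB => //; exact: cvg_cst.
  - exact: coordc.
- move=> x; apply: val_inj => /=; apply/funext => v; rewrite /segment.
  by rewrite /clamp min_r ?ler01// maxxx subr0 mul1r mul0r addr0.
- move=> x; apply: val_inj => /=; apply/funext => v; rewrite /segment.
  by rewrite /clamp minxx max_r ?ler01// subrr mul0r mul1r add0r.
Qed.
End segment.

(** Reduces a homotopy equivalence of realisations to a computation of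
    carriers: both straight-line homotopies to the identity exist because the
    composites enlarge carriers. *)
Lemma realisation_homotopy_equivalent (R : realType) (V W : finType)
    (K : {set {set V}}) (L : {set {set W}})
    (F : {ptws V -> R} -> {ptws W -> R}) (G : {ptws W -> R} -> {ptws V -> R}) :
  (forall x, realisation R K x ->
     [/\ realisation R L (F x), {for x, continuous F}
       & carrier x \subset carrier (G (F x))]) ->
  (forall y, realisation R L y ->
     [/\ realisation R K (G y), {for y, continuous G}
       & carrier y \subset carrier (F (G y))]) ->
  homotopy_equivalent R (set_type (realisation R K))
    (set_type (realisation R L)).
Proof.
move=> FP GP.
have FKL x : realisation R K x -> realisation R L (F x) by case/FP.
have GLK y : realisation R L y -> realisation R K (G y) by case/GP.
have Fc : continuous (corestrict FKL).
  by apply: corestrict_continuous => x /FP[].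
have Gc : continuous (corestrict GLK).
  by apply: corestrict_continuous => y /GP[].
exists (corestrict FKL), (corestrict GLK); split => //.
- apply: segment_homotopic.
    by move=> x; apply: continuous_comp; [exact: Fc|exact: Gc].
  by move=> x; have [] := FP _ (set_valP x).
- apply: segment_homotopic.
    by move=> y; apply: continuous_comp; [exact: Gc|exact: Fc].
  by move=> y; have [] := GP _ (set_valP y).
Qed.

(** * The gap map of a relation *)

(** One half of the Galois connection between subsets of V and of W defined by
    the relation; the other half is [common] of the converse relation. *)
Definition common (V W : finType) (r : V -> W -> bool) (A : {set V}) :
    {set W} :=
  [set w | [forall v in A, r v w]]%SET.

Lemma commonP (V W : finType) (r : V -> W -> bool) (A : {set V}) w :
  reflect (forall v, v \in A -> r v w) (w \in common r A).
Proof. by rewrite inE; exact: forall_inP. Qed.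

Lemma sub_common (V W : finType) (r : V -> W -> bool) (A : {set V}) :
  A \subset common (fun w v => r v w) (common r A).
Proof.
by apply/fintype.subsetP => v vA; apply/commonP => w /commonP wA; exact: wA.
Qed.

Lemma commonS (V W : finType) (r : V -> W -> bool) (A B : {set V}) :
  A \subset B -> common r B \subset common r A.
Proof.
move=> /fintype.subsetP AB; apply/fintype.subsetP => w /commonP wB.
by apply/commonP => v /AB; exact: wB.
Qed.

Lemma common_neq (V : finType) (A : {set V}) :
  common (fun v w => v != w) A = (~: A)%SET.
Proof.
apply/setP => w; rewrite finset.in_setC; apply/commonP/idP => [wA|wA v vA].
  by apply/negP => /wA; rewrite eqxx.
by apply: contraNneq wA => <-.
Qed.

Section gap_map.
Variables (R : realType) (V W : finType) (r : V -> W -> bool).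
Implicit Types x : V -> R.

Definition height (U : finType) (x : U -> R) : R := \big[Num.max/0]_v x v.

Definition peak (U : finType) (x : U -> R) : {set U} :=
  [set v | x v == height x]%SET.

(** How far the weights at the vertices unrelated to [w] stay below the
    maximum.  It is positive iff [w] is related to the whole peak, and equal to
    the maximum iff [w] is related to the whole carrier. *)
Definition gap x (w : W) : R :=
  height x - \big[Num.max/0]_(v | ~~ r v w) x v.

Definition gap_map (x : {ptws V -> R}) : {ptws W -> R} :=
  fun w => gap x w / \sum_w' gap x w'.

Lemma height_gt0 (U : finType) (x : U -> R) : in_simplex x -> 0 < height x.
Proof.
move=> [x0 x1]; rewrite lt_neqAle bigmax_ge_id andbT eq_sym.
apply/eqP => h0; have : \sum_v x v <= 0.
  by apply: sumr_le0 => v _; rewrite -h0; exact: le_bigmax.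
by rewrite x1 leNgt ltr01.
Qed.

Lemma peak_neq0 (U : finType) (x : U -> R) :
  in_simplex x -> peak x != finset.set0.
Proof.
move=> xD; apply/set0Pn; have [x0 x1] := xD.
have [v0 _|U0] := pickP (fun _ : U => true); last first.
  by move: x1; rewrite big_pred0// => /eqP; rewrite eq_sym oner_eq0.
have [v _ ve] :=
  Order.TotalTheory.eq_bigmax v0 predT x isT (fun v (_ : predT v) => x0 v).
by exists v; rewrite inE /height ve.
Qed.

Lemma peak_sub (U : finType) (x : U -> R) :
  in_simplex x -> peak x \subset carrier x.
Proof.
move=> xD; apply/fintype.subsetP => v; rewrite !inE => /eqP ->.
by rewrite gt_eqF// height_gt0.
Qed.

Lemma gap_ge0 x w : 0 <= gap x w.
Proof. by rewrite subr_ge0; apply: sub_bigmax. Qed.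

Lemma gap_neq0 x w : in_simplex x -> (gap x w != 0) = (w \in common r (peak x)).
Proof.
move=> xD.
have -> : (gap x w != 0) = (\big[Num.max/0]_(v | ~~ r v w) x v < height x).
  by rewrite -subr_gt0 lt_neqAle gap_ge0 andbT eq_sym.
apply/bigmax_ltP/commonP => [[_ xw] v|xw].
  by apply: contraLR => /xw; rewrite inE => /lt_eqF ->.
split=> [|v rvw]; first exact: height_gt0.
rewrite lt_neqAle le_bigmax andbT.
by apply: contra rvw => vp; apply: xw; rewrite inE.
Qed.

Lemma sum_gap_gt0 x :
  in_simplex x -> common r (peak x) != finset.set0 -> 0 < \sum_w gap x w.
Proof.
move=> xD /set0Pn[w wx]; rewrite (bigD1 w)//= ltr_pwDl//.
  by rewrite lt_neqAle eq_sym gap_neq0// wx gap_ge0.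
by apply: sumr_ge0 => *; exact: gap_ge0.
Qed.

Lemma gap_map_simplex (x : {ptws V -> R}) : in_simplex x ->
  common r (peak x) != finset.set0 -> in_simplex (gap_map x).
Proof.
move=> xD /(sum_gap_gt0 xD) s0; split=> [w|].
  by rewrite divr_ge0 ?gap_ge0// ltW.
by rewrite -mulr_suml divff// gt_eqF.
Qed.

Lemma carrier_gap_map (x : {ptws V -> R}) :
  in_simplex x -> carrier (gap_map x) = common r (peak x).
Proof.
move=> xD; apply/setP => w; rewrite inE mulf_eq0 negb_or invr_eq0 gap_neq0//.
have [wx|//] := boolP (w \in common r (peak x)).
by rewrite gt_eqF// sum_gap_gt0//; apply/set0Pn; exists w.
Qed.

Lemma common_peak_neq0 x : in_simplex x ->
  common r (carrier x) != finset.set0 -> common r (peak x) != finset.set0.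
Proof.
by move=> xD; apply: subset_neq0; apply: commonS; exact: peak_sub.
Qed.

(** A vertex related to the whole carrier attains the largest conceivable gap,
    namely [height x]; if such a vertex exists, the peak of the image consists
    of them. *)
Lemma peak_gap_map (x : {ptws V -> R}) : in_simplex x ->
  common r (carrier x) != finset.set0 ->
  peak (gap_map x) = common r (carrier x).
Proof.
move=> xD cx; have s0 := sum_gap_gt0 xD (common_peak_neq0 xD cx).
have gapE w : (gap x w == height x) = (w \in common r (carrier x)).
  rewrite /gap -subr_eq0 addrAC subrr add0r oppr_eq0.
  apply/eqP/commonP => [w0 v|wx].
    rewrite inE; apply: contraR => vw; rewrite eq_le (xD.1 v) andbT -w0.
    exact: le_bigmax_cond.
  by apply: bigmax_eq_id => v vw; rewrite le_eqVlt; apply/orP; left;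
    apply: contraR vw => v0; apply: wx; rewrite inE.
have heightE : height (gap_map x) = height x / \sum_w gap x w.
  have /set0Pn[w0] := cx; rewrite -gapE => /eqP w0E.
  apply/eqP; rewrite eq_le; apply/andP; split.
    apply/bigmax_leP; split=> [|w _].
      by rewrite divr_ge0 ?ltW// height_gt0.
    rewrite ler_pM2r ?invr_gt0// lerBlDr lerDl; exact: bigmax_ge_id.
  by rewrite -w0E; exact: (le_bigmax _ (gap_map x)).
have s1 : (\sum_w gap x w)^-1 != 0 by rewrite invr_eq0 gt_eqF.
by apply/setP => w; rewrite -gapE inE heightE (inj_eq (mulIf s1)).
Qed.

Lemma bigmax_continuous (P : pred V) :
  continuous (fun x : {ptws V -> R} => \big[Num.max/0]_(v | P v) x v : R).
Proof.
apply: continuous_big => [|v _]; first exact: max_continuous.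
exact: coord_continuous.
Qed.

Lemma gap_continuous w : continuous (fun x : {ptws V -> R} => gap x w : R).
Proof.
move=> x.
have height_cont : {for x, continuous (fun x : {ptws V -> R} => height x : R)}.
  exact: (@bigmax_continuous predT x).
exact: (continuousB height_cont
  (@bigmax_continuous (fun v => ~~ r v w) x)).
Qed.

Lemma gap_map_continuous (x : {ptws V -> R}) : in_simplex x ->
  common r (peak x) != finset.set0 -> {for x, continuous gap_map}.
Proof.
move=> xD /(sum_gap_gt0 xD) s0; apply: continuous_ptws => w.
have sum_cont :
    continuous (fun x : {ptws V -> R} => \sum_w' gap x w' : R).
  apply: continuous_big => [|w' _]; first exact: add_continuous.
  exact: gap_continuous.
have s1 : \sum_w' gap x w' != 0 by rewrite gt_eqF.
exact: (continuousM (@gap_continuous w x) (continuousV s1 (sum_cont x))).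
Qed.

End gap_map.


(** * Two dualities *)

Definition dowker_complex (V W : finType) (r : V -> W -> bool) :
    {set {set V}} :=
  [set s : {set V} | (s != finset.set0) && (common r s != finset.set0)]%SET.

(** The composite with the map of the converse relation has carrier
    r'(r(carrier x)), where r' is the converse: the closure of [carrier x] under
    the Galois connection. *)
Lemma dowker_gap_map (R : realType) (V W : finType) (r : V -> W -> bool)
    (r' := fun w v => r v w) (x : {ptws V -> R}) :
  realisation R (dowker_complex r) x ->
  [/\ realisation R (dowker_complex r') (gap_map r x),
      {for x, continuous (@gap_map R V W r)}
    & carrier x \subset carrier (gap_map r' (gap_map r x))].
Proof.
move=> /in_realisation[xD]; rewrite inE => /andP[_ cx].
have px := common_peak_neq0 xD cx; have yD := gap_map_simplex xD px.
split; last 2 first.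
- exact: gap_map_continuous.
- by rewrite carrier_gap_map// peak_gap_map//; exact: sub_common.
apply/in_realisation; split => //; rewrite inE carrier_gap_map// px /=.
exact: subset_neq0 (sub_common r (peak x)) (peak_neq0 xD).
Qed.

Theorem dowker_duality (R : realType) (V W : finType) (r : V -> W -> bool) :
  homotopy_equivalent R (set_type (realisation R (dowker_complex r)))
    (set_type (realisation R (dowker_complex (fun w v => r v w)))).
Proof.
apply: realisation_homotopy_equivalent => [x|y]; first exact: dowker_gap_map.
exact: (@dowker_gap_map _ _ _ (fun w v => r v w)).
Qed.

(** The maps below are indexed by all sets of vertices; as membership in [U] is
    part of the relation, the sets outside [U] get weight zero. *)
Definition avoids (V : finType) (U : {set {set V}}) (v : V) (s : {set V}) :
    bool :=
  (s \in U) && (v \notin s).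

Section complement_duality.
Variables (R : realType) (V : finType) (U : {set {set V}}).
Hypothesis U0 : finset.set0 \notin U.
Hypothesis UT : finset.setT \notin U.
Hypothesis U_up : forall s t : {set V},
  s \in U -> s \subset t -> t != finset.setT -> t \in U.

Definition complements : {set {set V}} := [set (~: s)%SET | s in U]%SET.

Lemma mem_complements (s : {set V}) : (s \in complements) = (~: s \in U)%SET.
Proof.
apply/imsetP/idP => [[t tU ->]|sU]; first by rewrite finset.setCK.
by exists (~: s)%SET; rewrite ?finset.setCK.
Qed.

(** Up to normalisation this is x |-> max x - x: it turns a weight function
    upside down. *)
Let antipode : {ptws V -> R} -> {ptws V -> R} := gap_map (fun v w => v != w).

(** The antipodal map need not send |U| into |complements|, since the peak of
    a point of |U| may lie outside [U].  The two maps that follow it correct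
    this: up to normalisation the result is x |-> max (t - x, 0), where
    t is the largest value such that the set where x >= t belongs to [U]. *)
Let coantipode (x : {ptws V -> R}) : {ptws V -> R} :=
  gap_map (fun s v => avoids U v s) (gap_map (avoids U) (antipode x)).

Lemma carrier_antipode (x : {ptws V -> R}) :
  in_simplex x -> carrier (antipode x) = (~: peak x)%SET.
Proof. by move=> xD; rewrite carrier_gap_map// common_neq. Qed.

(** Let s be the carrier of [x].  The peak of [coantipode x] consists of the
    vertices in no member of [U] contained in s; as s itself is such a member,
    this peak is disjoint from s. *)
Lemma coantipodeP (x : {ptws V -> R}) : realisation R U x ->
  [/\ realisation R complements (coantipode x),
      {for x, continuous coantipode}
    & carrier x \subset carrier (antipode (coantipode x))].
Proof.
move=> /in_realisation[xD xU].
have sN0 : (~: carrier x)%SET != finset.set0.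
  by rewrite -finset.subset0 finset.subCset finset.setC0 finset.subTset;
    apply: contraNneq UT => <-.
have cx : common (fun v w => v != w) (carrier x) != finset.set0.
  by rewrite common_neq.
have px := common_peak_neq0 xD cx.
have x1D : in_simplex (antipode x) := gap_map_simplex xD px.
have x1p : peak (antipode x) = (~: carrier x)%SET.
  by rewrite peak_gap_map// common_neq.
have sx : carrier x \in common (avoids U) (~: carrier x)%SET.
  by apply/commonP => v; rewrite finset.in_setC /avoids xU.
have p1 : common (avoids U) (peak (antipode x)) != finset.set0.
  by rewrite x1p; apply/set0Pn; exists (carrier x).
have x2D := gap_map_simplex x1D p1.
have x2c := carrier_gap_map (avoids U) x1D; rewrite x1p in x2c.
have c2 : common (fun s v => avoids U v s)
    (carrier (gap_map (avoids U) (antipode x))) != finset.set0.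
  by rewrite x2c; exact: subset_neq0 (sub_common _ _) sN0.
have p2 := common_peak_neq0 x2D c2.
have x3D := gap_map_simplex x2D p2.
split.
- apply/in_realisation; split=> //; rewrite mem_complements.
  (* A member e of the peak of the middle point lies in U, and no vertex of e
     is in the final carrier. *)
  have /set0Pn[e ep] := peak_neq0 x2D.
  have ec := fintype.subsetP (peak_sub x2D) _ ep; rewrite x2c in ec.
  have /set0Pn[v0 v0s] := sN0.
  have /andP[eU _] := commonP _ _ _ ec _ v0s.
  rewrite carrier_gap_map//; apply: U_up eU _ _.
    rewrite finset.subsetC; apply/fintype.subsetP => v /commonP/(_ e ep).
    by rewrite finset.in_setC => /andP[].
  by apply: contra p2 => /eqP s3T; rewrite -[X in X == _]finset.setCK s3T
    finset.setCT.
- apply: (@continuous_comp _ _ _ (fun z => gap_map (avoids U) (antipode z))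
    (gap_map (fun s v => avoids U v s))); last exact: gap_map_continuous.
  apply: (@continuous_comp _ _ _ antipode (gap_map (avoids U)));
    exact: gap_map_continuous.
- rewrite carrier_antipode// peak_gap_map// finset.subsetC.
  apply/fintype.subsetP => v /commonP; rewrite x2c => /(_ _ sx)/andP[_].
  by rewrite finset.in_setC.
Qed.

(** Applying the antipodal map twice gives back the carrier of [y], and then the
    two maps of Dowker type can only enlarge it. *)
Lemma antipodeP (y : {ptws V -> R}) : realisation R complements y ->
  [/\ realisation R U (antipode y), {for y, continuous antipode}
    & carrier y \subset carrier (coantipode (antipode y))].
Proof.
move=> /in_realisation[yD]; rewrite mem_complements => yU.
have yN0 : carrier y != finset.set0.
  exact: subset_neq0 (peak_sub yD) (peak_neq0 yD).
have cp : (~: carrier y \subset ~: peak y)%SET.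
  by rewrite finset.setCS; exact: peak_sub.
have yc : (~: carrier y)%SET != finset.set0.
  by apply: contraNneq U0 => <-.
have cy : common (fun v w => v != w) (carrier y) != finset.set0.
  by rewrite common_neq.
have py := common_peak_neq0 yD cy.
have xU : realisation R U (antipode y).
  apply/in_realisation; split; first exact: gap_map_simplex.
  rewrite carrier_antipode//; apply: U_up yU cp _.
  apply: contra (peak_neq0 yD) => /eqP pT.
  by rewrite -[peak y]finset.setCK pT finset.setCT.
split => //; first exact: gap_map_continuous.
have xD : in_simplex (antipode y) := gap_map_simplex yD py.
have xp : peak (antipode y) = (~: carrier y)%SET.
  by rewrite peak_gap_map// common_neq.
have cx : common (fun v w => v != w) (peak (antipode y)) != finset.set0.
  by rewrite xp common_neq finset.setCK.
have x1D : in_simplex (antipode (antipode y)) := gap_map_simplex xD cx.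
have x1c : carrier (antipode (antipode y)) = carrier y.
  by rewrite carrier_antipode// xp finset.setCK.
have c1 : common (avoids U) (carrier (antipode (antipode y))) != finset.set0.
  rewrite x1c; apply/set0Pn; exists (~: carrier y)%SET.
  by apply/commonP => v vy; rewrite /avoids yU finset.in_setC vy.
have x2D := gap_map_simplex x1D (common_peak_neq0 x1D c1).
by rewrite carrier_gap_map// peak_gap_map// x1c; exact: sub_common.
Qed.

(** [U] stands for the set of simplexes outside a subcomplex, and |U| for the
    complement of that subcomplex. *)
Theorem complement_duality :
  homotopy_equivalent R (set_type (realisation R complements))
    (set_type (realisation R U)).
Proof.
by apply: realisation_homotopy_equivalent => x;
  [exact: antipodeP|exact: coantipodeP].
Qed.

End complement_duality.

(** * The Alexander dual *)

Lemma external_simplex_sub (n : nat) (X : {set {set 'I_n.+1}})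
    (s : {set 'I_n.+1}) : s \in (simplex_boundary n :\: X)%SET ->
  exists2 e, e \in external_simplexes X & e \subset s.
Proof.
pose P := fun e : {set 'I_n.+1} => (e != finset.set0) && (e \notin X).
rewrite !inE => /and3P[sX s0 sT].
have /minset_exists[e /minsetP[/andP[e0 eX] emin] es] : P s by rewrite /P s0.
exists e => //; rewrite !inE e0 eX (sub_proper_trans es sT) /=.
apply/forallP => t; apply/implyP => /andP[t0 te]; apply: contraTT te => tX.
have tsub : t \subset e -> t = e.
  by move=> te; apply: emin => //; rewrite /P t0.
by apply/negP => /[dup] /proper_sub/tsub ->; rewrite fintype.properxx.
Qed.

(** A simplex s of the dual is the complement of a non-simplex of X, which
    contains an external simplex; so the vertices of s all avoid it. *)
Lemma alexander_dual_dowker (n : nat) (X : {set {set 'I_n.+1}}) :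
  simplicial_complex X ->
  alexander_dual X = dowker_complex (avoids (external_simplexes X)).
Proof.
move=> [X0 Xdown]; apply/setP => s; rewrite inE.
rewrite (mem_complements (simplex_boundary n :\: X)%SET s).
apply/idP/andP => [/[dup] sU /external_simplex_sub[e eE es]|[s0 /set0Pn[e]]].
  split.
    apply: contraTneq sU => ->.
    by rewrite finset.setC0 !inE fintype.properxx !andbF.
  apply/set0Pn; exists e; apply/commonP => v vs; rewrite /avoids eE /=.
  by apply: contraL vs => /(fintype.subsetP es); rewrite finset.in_setC.
move=> /commonP es; have /set0Pn[v0 /es/andP[eE _]] := s0.
have sub : e \subset (~: s)%SET.
  apply/fintype.subsetP => v ve; rewrite finset.in_setC.
  by apply/negP => /es/andP[_]; rewrite ve.
move: (eE); rewrite !inE => /and3P[/andP[e0 eT] eX _].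
have sN0 : (~: s)%SET != finset.set0 by exact: subset_neq0 sub e0.
rewrite sN0 finset.properT.
apply/and3P; split=> //.
  by apply: contra eX => sX; exact: Xdown sX e0 sub.
by apply: contra s0 => /eqP sT; rewrite -[s]finset.setCK sT finset.setCT.
Qed.

(** The union of some external simplexes is not the whole vertex set iff some
    vertex avoids all of them. *)
Lemma dual_complex_dowker (n : nat) (X : {set {set 'I_n.+1}}) :
  dual_complex X =
  dowker_complex (fun e v => avoids (external_simplexes X) v e).
Proof.
apply/setP => S; rewrite !inE.
have [//|/set0Pn[e0 e0S]] /= := eqVneq S finset.set0.
apply/andP/set0Pn => [[SE]|[v /commonP vS]].
  rewrite -finset.properT => /properP[_ [v _ vS]].
  exists v; apply/commonP => e eS; rewrite /avoids (fintype.subsetP SE)//=.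
  by apply: contra vS => ve; apply/bigcupP; exists e.
split; first by apply/fintype.subsetP => e /vS/andP[].
apply/eqP => ST; have : v \in finset.cover S by rewrite ST inE.
by move=> /bigcupP[e /vS/andP[_ /negP]].
Qed.

Lemma realisation_setD (R : realType) (V : finType) (K L : {set {set V}}) :
  realisation R K `\` realisation R L = realisation R (K :\: L)%SET.
Proof.
apply/seteqP; split=> x.
  move=> [/in_realisation[xD xK] xL]; apply/in_realisation; split=> //.
  rewrite finset.in_setD xK andbT; apply/negP => xL'.
  exact/xL/in_realisation.
move=> /in_realisation[xD]; rewrite finset.in_setD => /andP[xL xK].
split; first exact/in_realisation.
by move=> /in_realisation[_]; exact/negP.
Qed.

Theorem corollary9p6 (R : realType) (n : nat) (X : {set {set 'I_n.+1}})
    (hX : simplicial_complex X) (hsub : X \subset simplex_boundary n) :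
  homotopy_equivalent R
    (set_type (realisation R (alexander_dual X)))
    (set_type (realisation R (dual_complex X))) /\
  homotopy_equivalent R
    (set_type (realisation R (alexander_dual X)))
    (set_type (realisation R (simplex_boundary n) `\` realisation R X)).
Proof.
split.
  by rewrite alexander_dual_dowker// dual_complex_dowker; exact: dowker_duality.
rewrite realisation_setD.
apply: (@complement_duality R _ (simplex_boundary n :\: X)%SET).
- by rewrite !inE eqxx andbF.
- by rewrite !inE fintype.properxx !andbF.
- move=> s t; rewrite !inE => /and3P[sX s0 sT] st tT.
  have t0 : t != finset.set0 by exact: subset_neq0 st s0.
  rewrite t0 finset.properT tT !andbT; apply: contra sX => tX.
  exact: hX.2 tX s0 st.
Qed.
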